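(* Let $(\mathcal{A},\mathcal{E})$ be a finite, essentially small exact category. For a nonzero object $X$ define $\mu_\mathcal{E}(X)=\max\{\mu_\mathcal{E}(X') : X'\text{ indecomposable},\ X'\subset_\mathcal{E}X\}$ (maximum in $(\mathfrak{S}(\mathbb{N}),\lll)$); this agrees with $\mu_\mathcal{E}$ on indecomposable objects. Then this extended map is a measure on the poset of isomorphism classes of nonzero objects ordered by $\subset_\mathcal{E}$, i.e. $X\subset_\mathcal{E}Y$ implies $\mu_\mathcal{E}(X)\lll\mu_\mathcal{E}(Y)$.
   Context: $(\mathcal{A},\mathcal{E})$ is a Quillen exact category; admissible monics are morphisms $i$ with $(i,d)\in\mathcal{E}$ for some $d$. $X\subset_\mathcal{E}Y$ means there is an admissible monic $X\to Y$; $X\subsetneq_\mathcal{E}Y$ means there is one that is not an isomorphism. The $\mathcal{E}$-length $l_\mathcal{E}(X)$ is the supremum of all $n$ such that there is a chain $0=X_0\to\cdots\to X_n=X$ of admissible monics none of which is an isomorphism; $(\mathcal{A},\mathcal{E})$ is finite if $l_\mathcal{E}(X)<\infty$ for all $X$; in that case $\subset_\mathcal{E}$ is a partial order on isomorphism classes. $\mathfrak{S}(\mathbb{N})$ is the set of finite nonempty sequences of natural numbers, totally ordered by: $x\lll y$ iff $x=y$, or $x$ is a proper prefix of $y$, or at the first index $i$ where $x_i\neq y_i$ (both defined) one has $x_i>y_i$. For indecomposable $X$, $\mu_\mathcal{E}(X)$ is the $\lll$-maximum of $(l_\mathcal{E}(X_1),\dots,l_\mathcal{E}(X_n))$ over all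 chains $X_1\subsetneq_\mathcal{E}\cdots\subsetneq_\mathcal{E}X_n=X$ ($n\ge1$) with all $X_i$ indecomposable. A measure is an order-preserving map from a poset to a totally ordered set. *)

(* Defs.v *)
(* exact categories set up from scratch (no category-theory
   library is installed).  Composition is written in diagrammatic order:
   [cmp f g] is "first f, then g". *)
From HB Require Import structures.
From mathcomp Require Import all_boot all_order all_algebra.
Set Implicit Arguments. Unset Strict Implicit. Unset Printing Implicit Defensive.
Import GRing.Theory.
Local Open Scope ring_scope.

Record precat := PreCat {
  Obj : Type;
  Hom : Obj -> Obj -> zmodType;
  cmp : forall X Y Z : Obj, Hom X Y -> Hom Y Z -> Hom X Z;
  idm : forall X : Obj, Hom X X;
  cmpA : forall X Y Z W (f : Hom X Y) (g : Hom Y Z) (h : Hom Z W),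
      cmp (cmp f g) h = cmp f (cmp g h);
  cmp1l : forall X Y (f : Hom X Y), cmp (idm X) f = f;
  cmp1r : forall X Y (f : Hom X Y), cmp f (idm Y) = f;
  cmpDl : forall X Y Z (f g : Hom X Y) (h : Hom Y Z),
      cmp (f + g) h = cmp f h + cmp g h;
  cmpDr : forall X Y Z (f : Hom X Y) (g h : Hom Y Z),
      cmp f (g + h) = cmp f g + cmp f h
}.
Arguments cmp {p X Y Z}.
Arguments idm {p}.

Section Notions.
Variable C : precat.
Local Notation Ob := (Obj C).
Local Notation "f ;; g" := (cmp f g) (at level 40, left associativity).

Definition is_zero (X : Ob) : Prop := idm X = 0.

Definition is_iso (X Y : Ob) (f : Hom X Y) : Prop :=
  exists g : Hom Y X, f ;; g = idm X /\ g ;; f = idm Y.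

Definition is_biproduct (A B S : Ob) : Prop :=
  exists (i1 : Hom A S) (i2 : Hom B S) (p1 : Hom S A) (p2 : Hom S B),
    [/\ i1 ;; p1 = idm A, i2 ;; p2 = idm B, i1 ;; p2 = 0, i2 ;; p1 = 0
      & p1 ;; i1 + p2 ;; i2 = idm S].

Definition is_kernel (X Y Z : Ob) (i : Hom X Y) (d : Hom Y Z) : Prop :=
  i ;; d = 0 /\
  forall W (f : Hom W Y), f ;; d = 0 ->
    exists g : Hom W X, g ;; i = f /\ forall g' : Hom W X, g' ;; i = f -> g' = g.

Definition is_cokernel (X Y Z : Ob) (d : Hom Y Z) (i : Hom X Y) : Prop :=
  i ;; d = 0 /\
  forall W (f : Hom Y W), i ;; f = 0 ->
    exists g : Hom Z W, d ;; g = f /\ forall g' : Hom Z W, d ;; g' = f -> g' = g.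

Definition is_pushout (X Y X' Y' : Ob) (i : Hom X Y) (f : Hom X X')
    (f' : Hom Y Y') (i' : Hom X' Y') : Prop :=
  i ;; f' = f ;; i' /\
  forall W (g : Hom Y W) (h : Hom X' W), i ;; g = f ;; h ->
    exists u : Hom Y' W, (f' ;; u = g /\ i' ;; u = h) /\
      forall u' : Hom Y' W, f' ;; u' = g -> i' ;; u' = h -> u' = u.

Definition is_pullback (Y Z Y' Z' : Ob) (d : Hom Y Z) (f : Hom Z' Z)
    (f' : Hom Y' Y) (d' : Hom Y' Z') : Prop :=
  f' ;; d = d' ;; f /\
  forall W (g : Hom W Y) (h : Hom W Z'), g ;; d = h ;; f ->
    exists u : Hom W Y', (u ;; f' = g /\ u ;; d' = h) /\
      forall u' : Hom W Y', u' ;; f' = g -> u' ;; d' = h -> u' = u.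

End Notions.

Record addcat := AddCat {
  acat :> precat;
  has_zero : exists Z : Obj acat, is_zero Z;
  has_biproducts : forall A B : Obj acat, exists S, is_biproduct A B S
}.

Record exactcat := ExactCat {
  ecat :> addcat;
  Ex : forall X Y Z : Obj ecat, Hom X Y -> Hom Y Z -> Prop;
  Ex_kercoker : forall X Y Z (i : Hom X Y) (d : Hom Y Z),
      Ex i d -> is_kernel i d /\ is_cokernel d i;
  Ex_iso : forall X Y Z X' Y' Z' (i : Hom X Y) (d : Hom Y Z)
      (i' : Hom X' Y') (d' : Hom Y' Z')
      (a : Hom X' X) (b : Hom Y' Y) (c : Hom Z' Z),
      Ex i d -> is_iso a -> is_iso b -> is_iso c ->
      cmp i' b = cmp a i -> cmp d' c = cmp b d -> Ex i' d';
  Ex_E0 : forall A : Obj ecat, exists Z (d : Hom A Z), Ex (idm A) d;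
  Ex_E0op : forall A : Obj ecat, exists Z (i : Hom Z A), Ex i (idm A);
  Ex_E1 : forall X Y Z (i : Hom X Y) (j : Hom Y Z),
      (exists W (d : Hom Y W), Ex i d) -> (exists W (d : Hom Z W), Ex j d) ->
      exists W (d : Hom Z W), Ex (cmp i j) d;
  Ex_E1op : forall X Y Z (p : Hom X Y) (q : Hom Y Z),
      (exists W (i : Hom W X), Ex i p) -> (exists W (i : Hom W Y), Ex i q) ->
      exists W (i : Hom W X), Ex i (cmp p q);
  Ex_E2 : forall X Y X' (i : Hom X Y) (f : Hom X X'),
      (exists W (d : Hom Y W), Ex i d) ->
      exists Y' (f' : Hom Y Y') (i' : Hom X' Y'),
        is_pushout i f f' i' /\ exists W (d : Hom Y' W), Ex i' d;
  Ex_E2op : forall Y Z Z' (d : Hom Y Z) (f : Hom Z' Z),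
      (exists W (i : Hom W Y), Ex i d) ->
      exists Y' (f' : Hom Y' Y) (d' : Hom Y' Z'),
        is_pullback d f f' d' /\ exists W (i : Hom W Y'), Ex i d'
}.

Section ExactNotions.
Variable E : exactcat.
Local Notation Ob := (Obj E).

Definition adm_monic (X Y : Ob) (i : Hom X Y) : Prop :=
  exists Z (d : Hom Y Z), Ex i d.

Definition subE (X Y : Ob) : Prop := exists i : Hom X Y, adm_monic i.
Definition psubE (X Y : Ob) : Prop :=
  exists i : Hom X Y, adm_monic i /\ ~ is_iso i.

Inductive chainE : Ob -> nat -> Prop :=
| chainE0 : forall X, is_zero X -> chainE X 0
| chainES : forall X Y n, chainE X n -> psubE X Y -> chainE Y n.+1.

Definition lengthE (X : Ob) (n : nat) : Prop :=
  chainE X n /\ forall m, chainE X m -> (m <= n)%N.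

Definition finiteE : Prop :=
  forall X : Ob, exists N : nat, forall n, chainE X n -> (n <= N)%N.

Definition indecomposable (X : Ob) : Prop :=
  ~ is_zero X /\ forall A B : Ob, is_biproduct A B X -> is_zero A \/ is_zero B.

Inductive ichain : Ob -> seq nat -> Prop :=
| ichain1 : forall X n, indecomposable X -> lengthE X n -> ichain X [:: n]
| ichainS : forall X Y s n, ichain X s -> psubE X Y -> indecomposable Y ->
    lengthE Y n -> ichain Y (rcons s n).

End ExactNotions.

(* the total order <<< on finite sequences of naturals:
   x <<< y iff x = y, or x is a proper prefix of y, or at the first index where
   they differ x_i > y_i *)
Fixpoint lll (x y : seq nat) : bool :=
  match x, y with
  | [::], _ => true
  | _ :: _, [::] => false
  | a :: x', b :: y' => (b < a)%N || ((a == b) && lll x' y')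
  end.

Definition is_mu (E : exactcat) (X : Obj E) (s : seq nat) : Prop :=
  ichain X s /\ forall t, ichain X t -> lll t s.

Definition is_mu_ext (E : exactcat) (X : Obj E) (s : seq nat) : Prop :=
  (exists X', [/\ indecomposable X', subE X' X & is_mu X' s]) /\
  forall X' t, indecomposable X' -> subE X' X -> is_mu X' t -> lll t s.

(* Main.v *)
Require Import Defs.
From mathcomp Require Import all_boot all_order all_algebra.
From mathcomp Require Import boolp.

(* Everything rests on one finiteness observation: lengths strictly increase
   along proper admissible monics, so the length sequence of any chain of
   indecomposables ending inside X is a subsequence of [0, ..., l_E(X)].
   Every maximum in the definitions of mu_E and of its extension is therefore
   taken over a finite set in the total order <<<, and exists as soon as that
   set is nonempty.  For the extension, nonemptiness means that a nonzero X has
   an indecomposable admissible subobject; by induction on l_E(X): if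
   X = A (+) B with A, B nonzero, the split injection A -> X is a proper
   admissible monic.  Monotonicity on indecomposables holds because a proper
   inclusion X' < X extends every chain ending at X' by one step, and extending
   a sequence makes it <<<-larger; the extension is then monotone because
   subobjects of X are subobjects of any Y containing X. *)

Import GRing.Theory.
Set Implicit Arguments. Unset Strict Implicit. Unset Printing Implicit Defensive.

Lemma lll_prefix x y : lll x (x ++ y).
Proof. by elim: x => //= a x IH; rewrite eqxx IH orbT. Qed.

Lemma lll_refl x : lll x x.
Proof. by have := lll_prefix x [::]; rewrite cats0. Qed.

Lemma lll_total x y : lll x y || lll y x.
Proof. by elim: x y => [|a x IH] [|b y] //=; case: ltngtP => //= _. Qed.

Lemma lll_trans x y z : lll x y -> lll y z -> lll x z.
Proof.
elim: x y z => [|a x IH] [|b y] [|c z] //=.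
move=> /orP [ba | /andP [/eqP <- xy]] /orP [cb | /andP [/eqP <- yz]].
- by rewrite (ltn_trans cb ba).
- by rewrite ba.
- by rewrite cb.
- by rewrite eqxx (IH y z xy yz) orbT.
Qed.

Lemma lll_anti x y : lll x y -> lll y x -> x = y.
Proof.
elim: x y => [|a x IH] [|b y] //=; case: (ltngtP a b) => [_|_|<-] //= xy yx.
by rewrite (IH y).
Qed.

Lemma lll_max_seq (l : seq (seq nat)) :
  l != [::] -> exists2 m, m \in l & {in l, forall x, lll x m}.
Proof.
elim: l => // a [|b l] IH _.
  by exists a => [|x]; rewrite ?mem_seq1 // => /eqP ->; exact: lll_refl.
have [m ml mmax] := IH isT.
have /orP [am | ma] := lll_total a m.
  exists m => [|x]; first by rewrite in_cons ml orbT.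
  by rewrite in_cons => /predU1P [-> | /mmax].
exists a => [|x]; first exact: mem_head.
by rewrite in_cons => /predU1P [-> | /mmax xm]; [exact: lll_refl | exact: lll_trans ma].
Qed.

Lemma lll_max_finite (P : seq nat -> Prop) (cands : seq (seq nat)) :
  (forall x, P x -> x \in cands) -> (exists x, P x) ->
  exists2 m, P m & forall x, P x -> lll x m.
Proof.
move=> Pcands [x Px].
have [|m] := @lll_max_seq [seq y <- cands | `[< P y >]].
  by rewrite -size_eq0 size_filter -lt0n -has_count; apply/hasP; exists x;
    [exact: Pcands | exact/asboolP].
rewrite mem_filter => /andP [/asboolP Pm _] mmax.
by exists m => // y Py; apply: mmax; rewrite mem_filter Pcands // andbT; exact/asboolP.
Qed.

Lemma nat_max_bounded (P : nat -> Prop) N :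
  (exists n, P n) -> (forall n, P n -> n <= N) ->
  exists2 m, P m & forall n, P n -> n <= m.
Proof.
move=> [n Pn] PN.
have [|k /asboolP Pk|m /asboolP Pm mmax] := @ex_maxnP (fun n => `[< P n >]) N.
- by exists n; exact/asboolP.
- exact: PN.
- by exists m => // k Pk; apply: mmax; exact/asboolP.
Qed.

Definition subseqs (T : eqType) (s : seq T) : seq (seq T) :=
  [seq mask m s | m : (size s).-tuple bool].

Lemma mem_subseqs (T : eqType) (s t : seq T) : subseq t s -> t \in subseqs s.
Proof. by case/subseqP => m sz ->; apply/imageP; exists (Tuple (introT eqP sz)). Qed.

Lemma iota_subseq m n : m <= n -> subseq (iota 0 m) (iota 0 n).
Proof. by move=> mn; rewrite -(minn_idPl mn) -take_iota take_subseq. Qed.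

Section ExactCategory.

Variable E : exactcat.
Local Notation Ob := (Obj E).
Local Notation "f ;; g" := (cmp f g) (at level 40, left associativity).
Implicit Types X Y Z A B S : Ob.

(* Unqualified [Hom] is MathComp's linear-map constructor from vector.v. *)

Lemma cmp0l X Y Z (h : Defs.Hom Y Z) : (0%R : Defs.Hom X Y) ;; h = 0%R.
Proof. by apply: (addrI ((0%R : Defs.Hom X Y) ;; h)); rewrite addr0 -cmpDl addr0. Qed.

Lemma cmp0r X Y Z (h : Defs.Hom X Y) : h ;; (0%R : Defs.Hom Y Z) = 0%R.
Proof. by apply: (addrI (h ;; (0%R : Defs.Hom Y Z))); rewrite addr0 -cmpDr addr0. Qed.

Lemma hom_from_zero Z Y (f : Defs.Hom Z Y) : is_zero Z -> f = 0%R.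
Proof. by move=> Z0; rewrite -(cmp1l f) Z0 cmp0l. Qed.

Lemma is_iso_idm X : is_iso (idm X).
Proof. by exists (idm X); rewrite cmp1l. Qed.

Lemma is_iso_cmp X Y Z (f : Defs.Hom X Y) (g : Defs.Hom Y Z) :
  is_iso f -> is_iso g -> is_iso (f ;; g).
Proof.
move=> [f' [ff' f'f]] [g' [gg' g'g]]; exists (g' ;; f').
by rewrite !cmpA -(cmpA g) gg' -(cmpA f') f'f !cmp1l ff' g'g.
Qed.

Lemma is_iso_inv X Y (f : Defs.Hom X Y) :
  is_iso f -> exists2 g : Defs.Hom Y X, is_iso g & f ;; g = idm X.
Proof. by move=> [g [fg gf]]; exists g => //; exists f. Qed.

Lemma is_zero_iso X Y (f : Defs.Hom X Y) : is_iso f -> is_zero X -> is_zero Y.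
Proof. by move=> [g [_ gf]] X0; rewrite /is_zero -gf (hom_from_zero f X0) cmp0r. Qed.

Lemma iso_adm_monic X Y (f : Defs.Hom X Y) : is_iso f -> adm_monic f.
Proof.
move=> f_iso; have [Z [d Yd]] := Ex_E0 Y; exists Z, d.
apply: (Ex_iso (a := f) (b := idm Y) (c := idm Z) Yd) => //; try exact: is_iso_idm.
by rewrite cmp1l cmp1r.
Qed.

Lemma adm_monic_cmp X Y Z (i : Defs.Hom X Y) (j : Defs.Hom Y Z) :
  adm_monic i -> adm_monic j -> adm_monic (i ;; j).
Proof. exact: Ex_E1. Qed.

Lemma subE_refl X : subE X X.
Proof. by exists (idm X); apply: iso_adm_monic; exact: is_iso_idm. Qed.

Lemma subE_trans X Y Z : subE X Y -> subE Y Z -> subE X Z.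
Proof. by move=> [i i_adm] [j j_adm]; exists (i ;; j); exact: adm_monic_cmp. Qed.

Lemma psubE_subE X Y : psubE X Y -> subE X Y.
Proof. by move=> [i [i_adm _]]; exists i. Qed.

Lemma zero_adm_monic X : exists Z (i : Defs.Hom Z X), is_zero Z /\ adm_monic i.
Proof.
have [Z [i /[dup] iX /Ex_kercoker [[i0 iker] _]]] := Ex_E0op X.
exists Z, i; split; last by exists X, (idm X).
rewrite cmp1r in i0; have [g [_ g_uniq]] := iker Z 0%R (cmp0l _ _).
rewrite /is_zero (g_uniq (idm Z)) ?cmp1l //.
by apply/esym/g_uniq; rewrite cmp0l.
Qed.

Lemma psubE_iso X A B (f : Defs.Hom A B) : is_iso f -> psubE X A -> psubE X B.
Proof.
move=> f_iso [j [j_adm j_niso]]; exists (j ;; f); split.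
  exact: adm_monic_cmp j_adm (iso_adm_monic f_iso).
move=> jf_iso; apply: j_niso; have [g g_iso fg] := is_iso_inv f_iso.
by rewrite -[j]cmp1r -fg -cmpA; exact: is_iso_cmp.
Qed.

Lemma chainE_iso A B (f : Defs.Hom A B) n : is_iso f -> chainE A n -> chainE B n.
Proof.
move=> f_iso An; case: An f f_iso => [X X0 | X Y m Xm XY] f f_iso; first by constructor; exact: is_zero_iso f_iso X0.
by apply: chainES Xm _; exact: psubE_iso f_iso XY.
Qed.

Lemma chainE_exists X : exists n, chainE X n.
Proof.
have [Z [i [Z0 i_adm]]] := zero_adm_monic X.
have [i_iso | i_niso] := pselect (is_iso i).
  by exists 0; constructor; exact: is_zero_iso i_iso Z0.
by exists 1; apply: (chainES (chainE0 Z0)); exists i.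
Qed.

Lemma lengthE_uniq X a b : lengthE X a -> lengthE X b -> a = b.
Proof. by move=> [Xa amax] [Xb bmax]; apply/eqP; rewrite eqn_leq amax ?bmax. Qed.

Lemma lengthE_iso A B (f : Defs.Hom A B) n : is_iso f -> lengthE A n -> lengthE B n.
Proof.
move=> f_iso [An nmax]; split; first exact: chainE_iso f_iso An.
by move=> m Bm; have [g g_iso _] := is_iso_inv f_iso; apply/nmax/(chainE_iso g_iso).
Qed.

Lemma lengthE_psubE X Y a b : psubE X Y -> lengthE X a -> lengthE Y b -> a < b.
Proof. by move=> XY [Xa _] [_ bmax]; exact: bmax _ (chainES Xa XY). Qed.

Lemma lengthE_subE X Y a b : subE X Y -> lengthE X a -> lengthE Y b -> a <= b.
Proof.
move=> [i i_adm] Xa Yb; have [i_iso | i_niso] := pselect (is_iso i).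
  by rewrite (lengthE_uniq (lengthE_iso i_iso Xa) Yb).
by apply/ltnW/(lengthE_psubE _ Xa Yb); exists i.
Qed.

Lemma indecomposable_iso A B (f : Defs.Hom A B) :
  is_iso f -> indecomposable A -> indecomposable B.
Proof.
move=> [g [fg gf]] [A0 Adec]; have g_iso : is_iso g by exists f.
split; first by move=> /(is_zero_iso g_iso).
move=> P Q [i1 [i2 [p1 [p2 [e1 e2 e3 e4 e5]]]]]; apply: Adec.
have ggf h W (k : Defs.Hom B W) : h ;; g ;; (f ;; k) = h ;; k.
  by rewrite cmpA -(cmpA g) gf cmp1l.
exists (i1 ;; g), (i2 ;; g), (f ;; p1), (f ;; p2); split; rewrite ?ggf //.
by rewrite !cmpA -cmpDr -(cmpA p1) -(cmpA p2) -cmpDl e5 cmp1l fg.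
Qed.

Lemma ichain_iso A B (f : Defs.Hom A B) t : is_iso f -> ichain A t -> ichain B t.
Proof.
move=> f_iso At; case: At f f_iso => [X n Xi Xn | X Y s n Xs XY Yi Yn] f f_iso.
  by apply: ichain1; [exact: indecomposable_iso f_iso Xi | exact: lengthE_iso f_iso Xn].
apply: ichainS Xs _ _ _; first exact: psubE_iso f_iso XY.
  exact: indecomposable_iso f_iso Yi.
exact: lengthE_iso f_iso Yn.
Qed.

Lemma ichain_subseq_iota X t :
  ichain X t -> exists2 L, lengthE X L & subseq t (iota 0 L.+1).
Proof.
have iotaSr n : iota 0 n.+1 = rcons (iota 0 n) n by rewrite -addn1 iotaD cats1.
elim=> [{}X n _ Xn | {}X Y s n _ [L XL sL] XY _ Yn]; exists n => //.
  by rewrite sub1seq mem_iota add0n ltnSn.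
rewrite iotaSr -!cats1 cat_subseq //.
exact/(subseq_trans sL)/iota_subseq/(lengthE_psubE XY XL Yn).
Qed.

(* The inclusion A -> A (+) B is the push-out of the zero subobject 0 -> B
   along 0 -> A; push-outs of admissible monics are admissible (axiom E2). *)
Lemma biproduct_inl_adm_monic A B S (i1 : Defs.Hom A S) (i2 : Defs.Hom B S)
    (p1 : Defs.Hom S A) (p2 : Defs.Hom S B) :
  i1 ;; p1 = idm A -> i2 ;; p2 = idm B -> i1 ;; p2 = 0%R -> i2 ;; p1 = 0%R ->
  (p1 ;; i1 + p2 ;; i2)%R = idm S -> adm_monic i1.
Proof.
move=> e1 e2 e3 e4 e5; have [Z [i [Z0 i_adm]]] := zero_adm_monic B.
have [Y [f' [i' [[sq po] i'_adm]]]] := Ex_E2 (0%R : Defs.Hom Z A) i_adm.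
have [u [[f'u i'u] _]] := po S i2 i1 (etrans (hom_from_zero _ Z0) (esym (cmp0l _ _))).
pose v := (p1 ;; i' + p2 ;; f')%R.
have uv : u ;; v = idm Y.
  have [w [_ po_uniq]] := po Y f' i' sq.
  rewrite (po_uniq (idm Y)) ?cmp1r //; apply: po_uniq.
  - by rewrite -cmpA f'u /v cmpDr -!cmpA e4 e2 cmp0l cmp1l add0r.
  - by rewrite -cmpA i'u /v cmpDr -!cmpA e1 e3 cmp0l cmp1l addr0.
have vu : v ;; u = idm S by rewrite /v cmpDl !cmpA f'u i'u e5.
by rewrite -i'u; apply: adm_monic_cmp i'_adm (iso_adm_monic _); exists v.
Qed.

Lemma biproduct_psubE A B S : is_biproduct A B S -> ~ is_zero B -> psubE A S.
Proof.
move=> [i1 [i2 [p1 [p2 [e1 e2 e3 e4 e5]]]]] B0; exists i1; split.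
  exact: biproduct_inl_adm_monic e1 e2 e3 e4 e5.
move=> [h [i1h hi1]]; apply: B0; rewrite /is_zero -e2.
by rewrite -[i2]cmp1r -hi1 -cmpA cmpA e3 cmp0r.
Qed.

Lemma is_mu_ext_subE X Y s t : subE X Y -> is_mu_ext X s -> is_mu_ext Y t -> lll s t.
Proof.
move=> XY [[X' [X'i X'X X's]] _] [_ tmax].
exact: tmax X'i (subE_trans X'X XY) X's.
Qed.

Section Finite.

Hypothesis E_finite : finiteE E.

Lemma lengthE_exists X : exists n, lengthE X n.
Proof.
have [N XN] := E_finite X; have [n Xn nmax] := nat_max_bounded (chainE_exists X) XN.
by exists n.
Qed.

Lemma ichain_subseq_iota_subE X' X t L :
  subE X' X -> ichain X' t -> lengthE X L -> subseq t (iota 0 L.+1).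
Proof.
move=> X'X X't XL; have [L' X'L' tL'] := ichain_subseq_iota X't.
apply: subseq_trans tL' (iota_subseq _); rewrite ltnS.
exact: lengthE_subE X'X X'L' XL.
Qed.

Lemma is_mu_exists X : indecomposable X -> exists s, is_mu X s.
Proof.
move=> Xi; have [L XL] := lengthE_exists X.
have Xcands t : ichain X t -> t \in subseqs (iota 0 L.+1).
  by move=> Xt; apply/mem_subseqs/(ichain_subseq_iota_subE (subE_refl X) Xt XL).
have [s Xs smax] := lll_max_finite Xcands (ex_intro _ _ (ichain1 Xi XL)).
by exists s.
Qed.

Lemma is_mu_subE X' X t s :
  indecomposable X -> subE X' X -> is_mu X' t -> is_mu X s -> lll t s.
Proof.
move=> Xi [i i_adm] [X't _] [_ smax]; have [i_iso | i_niso] := pselect (is_iso i).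
  exact/smax/(ichain_iso i_iso X't).
have [n Xn] := lengthE_exists X.
have X'X : psubE X' X by exists i.
by apply: lll_trans (smax _ (ichainS X't X'X Xi Xn)); rewrite -cats1 lll_prefix.
Qed.

Lemma indecomposable_subE X : ~ is_zero X -> exists2 X0, indecomposable X0 & subE X0 X.
Proof.
have [n Xn] := lengthE_exists X.
elim/ltn_ind: n X Xn => n IH X Xn X0.
have [Xi | Xd] := pselect (indecomposable X); first by exists X => //; exact: subE_refl.
have [A [B [AB /not_orP [A0 B0]]]] :
    exists A B, is_biproduct A B X /\ ~ (is_zero A \/ is_zero B).
  move: Xd; apply: contra_notP => nodec; split => // A B AB.
  by move: nodec; apply: contra_notP => nAB; exists A, B.
have AX := biproduct_psubE AB B0; have [a Aa] := lengthE_exists A.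
have [X1 X1i X1A] := IH a (lengthE_psubE AX Aa Xn) A Aa A0.
by exists X1 => //; exact: subE_trans X1A (psubE_subE AX).
Qed.

Lemma is_mu_ext_exists X : ~ is_zero X -> exists s, is_mu_ext X s.
Proof.
move=> X0; have [L XL] := lengthE_exists X.
pose P u := exists X', [/\ indecomposable X', subE X' X & is_mu X' u].
have Pcands u : P u -> u \in subseqs (iota 0 L.+1).
  by move=> [Y [_ YX [Yu _]]]; exact/mem_subseqs/(ichain_subseq_iota_subE YX Yu XL).
have P_inhabited : exists u, P u.
  have [Y Yi YX] := indecomposable_subE X0; have [u Yu] := is_mu_exists Yi.
  by exists u, Y.
have [s [X' [X'i X'X X's]] smax] := lll_max_finite Pcands P_inhabited.
by exists s; split; [exists X' | move=> Y u Yi YX Yu; apply: smax; exists Y].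
Qed.

Lemma is_mu_extE X s : indecomposable X -> is_mu X s <-> is_mu_ext X s.
Proof.
move=> Xi; split=> [Xs | [[X' [_ X'X X's]] smax]].
  split; first by exists X; split => //; exact: subE_refl.
  by move=> X' t _ X'X X't; exact: is_mu_subE Xi X'X X't Xs.
have [s0 Xs0] := is_mu_exists Xi.
by rewrite (@lll_anti s s0) ?(is_mu_subE Xi X'X X's Xs0) ?(smax X) //; exact: subE_refl.
Qed.

End Finite.

End ExactCategory.

Theorem proposition7p16 (E : exactcat) (hfin : finiteE E) :
  (* the extended mu_E is well defined on nonzero objects *)
  (forall X : Obj E, ~ is_zero X -> exists s, is_mu_ext X s) /\
  (* it agrees with mu_E on indecomposable objects *)
  (forall (X : Obj E) s, indecomposable X -> (is_mu X s <-> is_mu_ext X s)) /\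
  (* it is a measure: X \subset_E Y implies mu_E(X) <<< mu_E(Y) *)
  (forall (X Y : Obj E) s t, ~ is_zero X -> ~ is_zero Y -> subE X Y ->
      is_mu_ext X s -> is_mu_ext Y t -> lll s t).
Proof.
split; first exact: is_mu_ext_exists.
split; first exact: is_mu_extE.
by move=> X Y s t _ _; exact: is_mu_ext_subE.
Qed.
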